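(* Let $L\ge 2$, $K\ge 1$, $N\ge 1$ be integers. Let $\boldsymbol{\mu}_1,\dots,\boldsymbol{\mu}_L\in\mathbb{R}^N$ be class centroids and let $\mathbf{C}=\mathrm{diag}(C_{1,1},\dots,C_{N,N})$ be a covariance matrix with $C_{n,n}>0$ for all $n$. Given the ground-truth class $\ell\in\{1,\dots,L\}$, let $\mathbf{x}_1,\dots,\mathbf{x}_K$ be independent random vectors, each distributed as $\mathcal{N}(\boldsymbol{\mu}_\ell,\mathbf{C})$, let $\overline{\mathbf{x}}=\frac1K\sum_{k=1}^K\mathbf{x}_k$, and let $\hat\ell=\operatorname{argmin}_{\ell'\in\{1,\dots,L\}}(\overline{\mathbf{x}}-\boldsymbol{\mu}_{\ell'})^{\mathsf T}\mathbf{C}^{-1}(\overline{\mathbf{x}}-\boldsymbol{\mu}_{\ell'})$ be the class estimate. Let $\Pr(\hat\ell=\ell\mid\ell,K)$ be the probability of correct classification when the ground-truth class is $\ell$. Then the classification accuracy $$A=\frac1L\sum_{\ell=1}^L\Pr(\hat\ell=\ell\mid\ell,K)$$ satisfies $$A\ \ge\ \max\left\{\frac1L,\ 1-(L-1)\,Q\!\left(\frac{\sqrt{K g_{\min}}}{2}\right)\right\},$$ where $g_{\min}=\min\{g_{\ell,\ell'} : \ell,\ell'\in\{1,\dots,L\},\ \ell\ne\ell'\}$.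
   Context: $Q(x)=\frac{1}{\sqrt{2\pi}}\int_x^\infty e^{-t^2/2}\,dt$ is the Gaussian Q-function. The discriminant gain between classes $\ell$ and $\ell'$ is $g_{\ell,\ell'}=(\boldsymbol{\mu}_\ell-\boldsymbol{\mu}_{\ell'})^{\mathsf T}\mathbf{C}^{-1}(\boldsymbol{\mu}_\ell-\boldsymbol{\mu}_{\ell'})$ (the symmetric Kullback-Leibler divergence between $\mathcal{N}(\boldsymbol{\mu}_\ell,\mathbf{C})$ and $\mathcal{N}(\boldsymbol{\mu}_{\ell'},\mathbf{C})$). The ground-truth class is uniformly distributed on $\{1,\dots,L\}$, so that $A$ is the overall probability of correct classification and $\hat\ell$ is the maximum likelihood (equivalently, maximum a posteriori) class estimate from $\overline{\mathbf{x}}$. The accuracy is conditioned on successful transmission of $\overline{\mathbf{x}}$, i.e. the classifier observes $\overline{\mathbf{x}}$ exactly. *)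

(* Defs.v *)
From HB Require Import structures.
From mathcomp Require Import all_boot all_order all_algebra.
From mathcomp Require Import all_classical all_reals all_analysis.

Set Implicit Arguments.
Unset Strict Implicit.
Unset Printing Implicit Defensive.

Import Order.TTheory GRing.Theory Num.Theory.
Import numFieldNormedType.Exports.

Local Open Scope classical_set_scope.
Local Open Scope ring_scope.

Section cV_measurable.
Context (R : realType) (N : nat).

Let coords : 'I_N -> 'cV[R]_N -> R := fun i x => x i ord0.

Let cV_set0 : g_sigma_preimage coords set0.
Proof. exact: sigma_algebra0. Qed.

Let cV_setC A : g_sigma_preimage coords A -> g_sigma_preimage coords (~` A).
Proof. exact: sigma_algebraC. Qed.

Let cV_bigcup (F : (set 'cV[R]_N)^nat) :
  (forall i, g_sigma_preimage coords (F i)) ->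
  g_sigma_preimage coords (\bigcup_i (F i)).
Proof. exact: sigma_algebra_bigcup. Qed.

(* The Borel sigma-algebra of R^N, generated by the coordinate maps (the
   same construction as the library's one on n.-tuple T). *)
HB.instance Definition _ :=
  @isMeasurable.Build (measure_tuple_display default_measure_display)
    ('cV[R]_N) (g_sigma_preimage coords) cV_set0 cV_setC cV_bigcup.

End cV_measurable.

Lemma measurable_coord (R : realType) (N : nat) (i : 'I_N) :
  measurable_fun [set: 'cV[R]_N] (fun x : 'cV[R]_N => x i ord0).
Proof.
move=> _ Y mY; rewrite setTI; apply: sub_sigma_algebra => /=.
rewrite -bigcup_seq/=; exists i => /=; first by rewrite mem_index_enum.
by exists Y => //; rewrite setTI.
Qed.

Lemma measurable_fun_cVP (R : realType) (N : nat) d (T : measurableType d)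
    (f : T -> 'cV[R]_N) :
  measurable_fun [set: T] f <->
  forall i, measurable_fun [set: T] (fun x => f x i ord0).
Proof.
split=> [mf i|mf].
  exact: (measurableT_comp (measurable_coord i) mf).
apply: (@measurability _ _ _ _ setT f
  (\big[setU/set0]_(i < N) preimage_set_system setT
     (fun x : 'cV[R]_N => x i ord0) measurable)) => //.
move=> _ [B + <-]; rewrite -bigcup_seq => -[i _ [C mC <-]].
by rewrite !setTI -[X in measurable X]setTI; exact: mf.
Qed.

Section cV_lebesgue.
Context (R : realType).

Definition cV_cons (N : nat) (p : measurableTypeR R * 'cV[R]_N) : 'cV[R]_N.+1 :=
  col_mx (p.1%:M : 'cV[R]_1) p.2.

Lemma cV_cons0 N (p : measurableTypeR R * 'cV[R]_N) : cV_cons p ord0 ord0 = p.1.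
Proof.
have -> : (ord0 : 'I_N.+1) = lshift N (ord0 : 'I_1) by exact/val_inj.
by rewrite [LHS](@col_mxEu _ 1 N 1) mxE mulr1n.
Qed.

Lemma cV_consS N (p : measurableTypeR R * 'cV[R]_N) (i : 'I_N) :
  cV_cons p (lift ord0 i) ord0 = p.2 i ord0.
Proof.
have -> : lift ord0 i = rshift 1 i by exact/val_inj.
exact: (@col_mxEd _ 1 N 1).
Qed.

Lemma measurable_cV_cons N :
  measurable_fun [set: measurableTypeR R * 'cV[R]_N] (@cV_cons N).
Proof.
apply/measurable_fun_cVP => i; case: (unliftP ord0 i) => [j|] ->.
  under eq_fun do rewrite cV_consS.
  exact: (measurableT_comp (measurable_coord j) measurable_snd).
under eq_fun do rewrite cV_cons0.
exact: measurable_fst.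
Qed.

HB.instance Definition _ N :=
  isMeasurableFun.Build _ _ _ _ (@cV_cons N) (@measurable_cV_cons N).

Definition cV_uncons (N : nat) (x : 'cV[R]_N.+1) : measurableTypeR R * 'cV[R]_N :=
  (x ord0 ord0, \col_i x (lift ord0 i) ord0).

Lemma cV_consK N : cancel (@cV_cons N) (@cV_uncons N).
Proof.
case=> t v; rewrite /cV_uncons cV_cons0; congr (_, _).
by apply/colP => i; rewrite mxE cV_consS.
Qed.

Lemma measurable_cV_uncons N : measurable_fun [set: 'cV[R]_N.+1] (@cV_uncons N).
Proof.
apply: measurable_fun_pair; first exact: measurable_coord.
apply/measurable_fun_cVP => i; under eq_fun do rewrite mxE.
exact: measurable_coord.
Qed.

Section cV_prod.
Context (N : nat) (m : {sigma_finite_measure set 'cV[R]_N -> \bar R}).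

Definition cV_prod : set 'cV[R]_N.+1 -> \bar R :=
  pushforward (@lebesgue_measure R \x m)%E (@cV_cons N).

Let mcons (A : set 'cV[R]_N.+1) :
  measurable A -> measurable (@cV_cons N @^-1` A).
Proof.
by move=> mA; rewrite -[X in measurable X]setTI; exact: measurable_cV_cons.
Qed.

Let cV_prod0 : cV_prod set0 = 0%E.
Proof. by rewrite /cV_prod /pushforward preimage_set0 measure0. Qed.

Let cV_prod_ge0 A : (0 <= cV_prod A)%E.
Proof. exact: (measure_ge0 (@lebesgue_measure R \x m)%E). Qed.

Let cV_prod_sigma_additive : semi_sigma_additive cV_prod.
Proof.
move=> F mF tF mUF; rewrite /cV_prod /pushforward preimage_bigcup.
apply: measure_semi_sigma_additive => [n||]; first exact: mcons.
- apply/trivIsetP => /= i j _ _ ij; rewrite -preimage_setI.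
  by move/trivIsetP : tF => /(_ _ _ _ _ ij) ->//; rewrite preimage_set0.
- by rewrite -preimage_bigcup; exact: mcons.
Qed.

HB.instance Definition _ := isMeasure.Build _ _ _ cV_prod
  cV_prod0 cV_prod_ge0 cV_prod_sigma_additive.

Let cV_prod_sigma_finite : sigma_finite setT cV_prod.
Proof.
have /sigma_finiteP[F [TF ndF Foo]] := sigma_finiteT (@lebesgue_measure R).
have /sigma_finiteP[G [TG ndG Goo]] := sigma_finiteT m.
exists (fun k => @cV_uncons N @^-1` (F k `*` G k)) => [|k].
  rewrite -preimage_bigcup (_ : \bigcup_i _ = setT) ?preimage_setT//.
  rewrite -setXTT TF TG predeqE => -[x y]; split.
    by move=> [n _ []/= ? ?]; split; exists n.
  move=> [/= [n _ Fnx] [k _ Gky]]; exists (maxn n k) => //; split.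
  - by move: x Fnx; exact/subsetPset/ndF/leq_maxl.
  - by move: y Gky; exact/subsetPset/ndG/leq_maxr.
have [mF Fk] := Foo k; have [mG Gk] := Goo k.
have mFG : measurable (F k `*` G k) by exact: measurableX.
split.
  by rewrite -[X in measurable X]setTI; exact: measurable_cV_uncons.
rewrite /cV_prod /pushforward -comp_preimage.
rewrite (_ : _ \o _ = id); last by apply/funext => p /=; rewrite cV_consK.
rewrite preimage_id product_measure1E//.
by rewrite lte_mul_pinfty// ge0_fin_numE.
Qed.

HB.instance Definition _ :=
  Measure_isSigmaFinite.Build _ _ _ cV_prod cV_prod_sigma_finite.

End cV_prod.

(* N-dimensional Lebesgue measure: the N-fold product of the Lebesgue measure
   of R, on column vectors. The space R^0 is a point, of mass 1. *)
Fixpoint cV_lebesgue (N : nat) :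
    {sigma_finite_measure set 'cV[R]_N -> \bar R} :=
  match N with
  | 0 =>
      [the {sigma_finite_measure set 'cV[R]_0 -> \bar R} of
         \d_(0 : 'cV[R]_0)]
  | N'.+1 =>
      [the {sigma_finite_measure set 'cV[R]_N'.+1 -> \bar R} of
         cV_prod (cV_lebesgue N')]
  end.

Lemma cV_lebesgue_box (N : nat) (B : 'I_N -> set R) :
  (forall i, measurable (B i)) ->
  cV_lebesgue N [set x : 'cV[R]_N | forall i, B i (x i ord0)] =
  (\prod_(i < N) @lebesgue_measure R (B i))%E.
Proof.
elim: N B => [B _|N IHN B mB].
  rewrite big_ord0 (_ : [set _ | _] = setT); first exact: diracT.
  by apply/seteqP; split=> // x _; case.
rewrite big_ord_recl -IHN//=.
have mbox : measurable
    [set x : 'cV[R]_N | forall i, B (lift ord0 i) (x i ord0)].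
  rewrite (_ : [set _ | _] = \big[setI/setT]_(i < N)
      ((fun x : 'cV[R]_N => x i ord0) @^-1` B (lift ord0 i))).
    apply: bigsetI_measurable => i _.
    by rewrite -[X in measurable X]setTI; exact: measurable_coord.
  by rewrite -bigcap_seq; apply/seteqP; split => x /= xB i => [_|]; apply: xB;
    rewrite /= ?mem_index_enum.
rewrite -product_measure1E//; last exact: (mB ord0).
suff <- : @cV_cons N @^-1` [set x | forall i, B i (x i ord0)] =
    B ord0 `*` [set x : 'cV[R]_N | forall i, B (lift ord0 i) (x i ord0)] by [].
apply/seteqP; split => [[t v] /= tvB|[t v] /= [tB vB] i].
  split => [|i]; first by have := tvB ord0; rewrite cV_cons0.
  by have := tvB (lift ord0 i); rewrite cV_consS.
by case: (unliftP ord0 i) => [j|] ->; rewrite ?cV_consS ?cV_cons0.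
Qed.

End cV_lebesgue.

Section gaussian.
Context (R : realType).

Definition quad_form (N : nat) (C : 'M[R]_N) (u : 'cV[R]_N) : R :=
  (u^T *m invmx C *m u) ord0 ord0.

Definition gaussian_pdf (N : nat) (m : 'cV[R]_N) (C : 'M[R]_N)
    (x : 'cV[R]_N) : R :=
  (Num.sqrt ((2 * pi) ^+ N * \det C))^-1 * expR (- quad_form C (x - m) / 2).

(* The law of X under P is N(m, C), by its density; C is meant to be positive
   definite. *)
Definition is_gaussian d (T : measurableType d) (P : probability T R)
    (N : nat) (m : 'cV[R]_N) (C : 'M[R]_N) (X : {mfun T >-> 'cV[R]_N}) : Prop :=
  forall B : set 'cV[R]_N, measurable B ->
    distribution P X B =
    (\int[cV_lebesgue R N]_(x in B) (gaussian_pdf m C x)%:E)%E.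

Definition mutually_independent d (T : measurableType d)
    (P : probability T R) (N K : nat) (X : 'I_K -> {mfun T >-> 'cV[R]_N}) :
    Prop :=
  forall (J : {set 'I_K}) (B : 'I_K -> set 'cV[R]_N),
    (forall k, measurable (B k)) ->
    P (\bigcap_(k in [set` J]) (X k @^-1` B k)) =
    (\prod_(k in J) P (X k @^-1` B k))%E.

Definition Qfun (x : R) : R :=
  (Num.sqrt (2 * pi))^-1 *
  \int[@lebesgue_measure R]_(t in `[x, +oo[) expR (- t ^+ 2 / 2).

End gaussian.

Section classification.
Context (R : realType) (L K N : nat).

Definition sample_mean (Omega : Type) (X : 'I_K -> Omega -> 'cV[R]_N)
    (w : Omega) : 'cV[R]_N :=
  K%:R^-1 *: \sum_(k < K) X k w.

(* lhat x is an argmin over l of (x - mu l)^T C^-1 (x - mu l); ties may be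
   broken in any way that makes lhat measurable. *)
Definition is_argmin_classifier (mu : 'I_L -> 'cV[R]_N) (C : 'M[R]_N)
    (lhat : 'cV[R]_N -> 'I_L) : Prop :=
  (forall l, measurable (lhat @^-1` [set l])) /\
  (forall x l, quad_form C (x - mu (lhat x)) <= quad_form C (x - mu l)).

Definition discriminant_gain (mu : 'I_L -> 'cV[R]_N) (C : 'M[R]_N)
    (l l' : 'I_L) : R :=
  quad_form C (mu l - mu l').

(* The minimum is taken in \bar R only to have a neutral element; it is
   finite as soon as 2 <= L. *)
Definition min_gain (mu : 'I_L -> 'cV[R]_N) (C : 'M[R]_N) : R :=
  fine (\big[Order.min/+oo%E]_(p : 'I_L * 'I_L | p.1 != p.2)
          (discriminant_gain mu C p.1 p.2)%:E).

(* P l is the conditional probability given that the true class is l. *)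
Definition accuracy d (Omega : measurableType d)
    (P : 'I_L -> probability Omega R) (X : 'I_K -> {mfun Omega >-> 'cV[R]_N})
    (lhat : 'cV[R]_N -> 'I_L) : R :=
  L%:R^-1 *
  \sum_(l < L) fine (P l [set w | lhat (sample_mean (fun k => X k) w) = l]).

End classification.

(* Main.v *)
(* Everything reduces to one-dimensional Gaussian laws.  The K*N coordinates
   of the samples are independent Gaussian variables, so the coordinates of
   the sample mean are independent with variances C_nn / K, and the mean
   itself has the density of N(mu_l, C / K).

   Accuracy at least 1/L: the likelihood under class l dominates every other
   likelihood on the decision region of l, so P_l(lhat = l) >= P_0(lhat = l)
   for a fixed class 0, and the latter probabilities sum to 1.

   The other bound: lhat <> l forces some l' <> l to be at least as close to
   the mean as l.  This is the event that a linear functional of the mean, of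
   law N(0, g / K) with g = g_{l,l'}, exceeds g / 2, which has probability
   Q(sqrt(K g) / 2) provided g > 0.  When g_min = 0 coinciding centroids make
   this fail, but then Q(0) = 1/2 and (L - 1) (L - 2) >= 0 make 1/L the larger
   of the two bounds. *)

From HB Require Import structures.
Require Import Defs.
From mathcomp Require Import all_boot all_order all_algebra.
From mathcomp Require Import all_classical all_reals all_analysis.
From mathcomp Require Import measurable_realfun ring lra.

Set Implicit Arguments.
Unset Strict Implicit.
Unset Printing Implicit Defensive.

Import Order.TTheory GRing.Theory Num.Theory.
Import numFieldNormedType.Exports.

Local Open Scope classical_set_scope.
Local Open Scope ring_scope.

(** * One-dimensional Gaussian laws *)

Section gauss.
Context (R : realType).
Implicit Types m s : R.

Local Notation RR := (measurableTypeR R).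
Local Notation leb := (@lebesgue_measure R).

Definition affine m s (x : RR) : RR := s * x + m.

Lemma measurable_affine m s : measurable_fun [set: RR] (affine m s).
Proof. by apply: measurable_funD => //; exact: measurable_funM. Qed.

HB.instance Definition _ m s :=
  isMeasurableFun.Build _ _ _ _ (affine m s) (measurable_affine m s).

(* Unlike [normal_prob m s], which is a uniform law at [s = 0], this is the
   Dirac mass at [m] there; [s] may also be negative. *)
Definition gauss m s : probability RR R :=
  distribution (normal_prob 0 1) (affine m s).

(** Lebesgue measure is determined by its values on half-open intervals, so these suffice. A
    negative [s] reverses them and moves the open end to the right. *)
Lemma lebesgue_measure_affine m s A : s != 0 -> measurable A ->
  leb A = (`|s|%:E * leb (affine m s @^-1` A))%E.
Proof.
move=> s0 mA.
pose k : {nonneg R} := NngNum (normr_ge0 s).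
rewrite (@lebesgue_measure_unique _
  (mscale k (pushforward leb (affine m s))))//.
move=> _ [[a b] _ <-].
change (leb `]a, b] = `|s|%:E * leb (affine m s @^-1` `]a, b]))%E.
have [s_gt0|s_lt0|/eqP] := ltgtP s 0; last by rewrite (negbTE s0).
  rewrite (_ : _ @^-1` _ = `[(b - m) / s, (a - m) / s[%classic); last first.
    apply/seteqP; split => x /=; rewrite !in_itv/= /affine;
      rewrite ler_ndivrMr// ltr_ndivlMr//; lra.
  rewrite !lebesgue_measure_itv/= !lte_fin ltr_nM2r ?invr_lt0// ltrD2r.
  case: ifPn => // _; rewrite ?mule0// -EFinM; congr (_%:E).
  by rewrite -mulrBl mulrC ltr0_norm//; field.
rewrite (_ : _ @^-1` _ = `](a - m) / s, (b - m) / s]%classic); last first.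
  apply/seteqP; split => x /=; rewrite !in_itv/= /affine;
    rewrite ler_pdivlMr// ltr_pdivrMr//; lra.
rewrite !lebesgue_measure_itv/= !lte_fin ltr_pM2r ?invr_gt0// ltrD2r.
case: ifPn => // _; rewrite ?mule0// -EFinM; congr (_%:E).
by rewrite -mulrBl mulrC gtr0_norm//; field.
Qed.

Lemma normal_pdf_affine m s x : s != 0 ->
  normal_pdf 0 1 x = `|s| * normal_pdf m s (affine m s x).
Proof.
move=> s0; rewrite !normal_pdfE ?oner_neq0// /normal_peak mulrA; congr (_ * _).
  rewrite expr1n mul1r -[in RHS]mulrnAr sqrtrM ?sqr_ge0// sqrtr_sqr invfM mulrA.
  by rewrite divff ?mul1r// normr_eq0.
rewrite /normal_fun /affine; congr expR.
by field.
Qed.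

(** Change of variables: Lebesgue measure is [|s|] times its image under [affine m s], and that
    factor is the Jacobian relating the two densities. *)
Lemma gaussE m s A : s != 0 -> measurable A -> gauss m s A = normal_prob m s A.
Proof.
move=> s0 mA; rewrite [LHS]/(normal_prob 0 1 (affine m s @^-1` A)) /normal_prob.
pose k : {nonneg R} := NngNum (normr_ge0 s).
have mpdf (D : set RR) : measurable_fun D (EFin \o normal_pdf m s).
  apply: measurable_funTS; apply/measurable_EFinP.
  exact: measurable_normal_pdf.
rewrite [RHS](_ : _ = \int[mscale k (pushforward leb (affine m s))]_(x in A)
    (normal_pdf m s x)%:E)%E; last first.
  apply: eq_measure_integral => B mB _ /=.
  exact: lebesgue_measure_affine.
rewrite ge0_integral_mscale//; last first.
  by move=> x _; rewrite lee_fin normal_pdf_ge0.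
rewrite (ge0_integral_pushforward (measurable_affine m s))//; last first.
  by move=> x _; rewrite lee_fin normal_pdf_ge0.
rewrite -ge0_integralZl//.
- by apply: eq_integral => x _ /=; rewrite -EFinM -normal_pdf_affine.
- by rewrite -[X in measurable X]setTI; exact: measurable_affine.
- apply: (measurableT_comp (mpdf setT)).
  exact: measurable_funTS (measurable_affine m s).
- by move=> x _; rewrite lee_fin normal_pdf_ge0.
Qed.

Lemma gauss_affine a b m s A :
  gauss m s (affine b a @^-1` A) = gauss (a * m + b) (a * s) A.
Proof.
have E n u B : gauss n u B = normal_prob 0 1 (affine n u @^-1` B) by [].
rewrite !E -comp_preimage; suff -> : affine b a \o affine m s =
  affine (a * m + b) (a * s) by [].
by apply/funext => x /=; rewrite /affine; ring.
Qed.

Lemma gauss0 m (A : set RR) : gauss m 0 A = (\1_A m)%:E.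
Proof.
pose gam : probability RR R := normal_prob 0 1.
rewrite [LHS]/(gam (affine m 0 @^-1` A)).
have affE x : affine m 0 x = m by rewrite /affine mul0r add0r.
have [Am|Am] := pselect (A m).
  rewrite indicE mem_set//= -(probability_setT gam).
  by congr (gam _); apply/seteqP; split => // x _ /=; rewrite affE.
rewrite indicE memNset//=; apply: etrans _ (measure0 gam).
by congr (gam _); apply/seteqP; split => // x /=; rewrite affE.
Qed.

Lemma normal_prob_sqr m s t : s ^+ 2 = t ^+ 2 ->
  normal_prob m s = normal_prob m t.
Proof.
move=> st; have st0 : (s == 0) = (t == 0).
  by rewrite -[s == 0](sqrf_eq0) st sqrf_eq0.
apply/funext => A; rewrite /normal_prob; apply: eq_integral => x _.
by rewrite /normal_pdf st0 /normal_peak /normal_fun st.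
Qed.

(** The law depends on the deviation only through the variance, so any [t] with the right square may
    be used for a sum or a reflection. *)
Lemma gauss_sqr m s t A : measurable A -> s ^+ 2 = t ^+ 2 ->
  gauss m s A = gauss m t A.
Proof.
move=> mA st; have [s0|s0] := eqVneq s 0.
  by suff -> : t = s by []; apply/eqP; rewrite s0 -sqrf_eq0 -st s0 expr0n.
have t0 : t != 0 by rewrite -sqrf_eq0 -st sqrf_eq0.
by rewrite !gaussE// (normal_prob_sqr m st).
Qed.

(** The joint density of a summand [x] and the sum [z], factored as the density of [z] times the
    conditional density of [x] given [z]. *)
Lemma normal_pdf_conv m m' s s' t x z : s != 0 -> s' != 0 -> t != 0 ->
  t ^+ 2 = s ^+ 2 + s' ^+ 2 ->
  normal_pdf m s x * normal_pdf (m' + x) s' z =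
  normal_pdf (m + m') t z *
  normal_pdf (m + (z - m - m') * s ^+ 2 / t ^+ 2) (s * s' / t) x.
Proof.
move=> s0 s'0 t0 tE.
have p0 := pi_gt0 R.
rewrite !normal_pdfE//; last by rewrite !mulf_neq0// invr_eq0.
rewrite mulrACA [RHS]mulrACA; congr (_ * _).
  rewrite /normal_peak -!invfM -!sqrtrM; last 2 first.
    by rewrite mulrn_wge0// mulr_ge0 ?sqr_ge0// ltW.
    by rewrite mulrn_wge0// mulr_ge0 ?sqr_ge0// ltW.
  by congr (Num.sqrt _)^-1; field.
rewrite /normal_fun -!expRD; congr expR.
rewrite !expr_div_n !exprMn tE.
have t20 : s ^+ 2 + s' ^+ 2 != 0 by rewrite -tE sqrf_eq0.
by field; rewrite s0 s'0 t20.
Qed.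

(** The Radon-Nikodym derivative and [normal_pdf] have equal integrals over every measurable set,
    hence agree almost everywhere. *)
Lemma ge0_integral_normal_prob m s (f : RR -> \bar R) :
  measurable_fun setT f -> (forall x, 0 <= f x)%E ->
  (\int[normal_prob m s]_x f x = \int[leb]_x (f x * (normal_pdf m s x)%:E))%E.
Proof.
move=> mf f0; have dom := normal_prob_dominates m s.
have mpdf : measurable_fun [set: RR] (EFin \o normal_pdf m s).
  by apply/measurable_EFinP; exact: measurable_normal_pdf.
have iRN := Radon_Nikodym_SigmaFinite.f_integrable dom.
rewrite -(Radon_Nikodym_SigmaFinite.change_of_variables dom)//.
apply: ae_eq_integral => //.
- by apply: emeasurable_funM => //; exact: measurable_int iRN.
- exact: emeasurable_funM.
- apply: ae_eqe_mul2l; apply: integral_ae_eq => // A _ mA.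
  by rewrite -(Radon_Nikodym_SigmaFinite.f_integral dom).
Qed.

(** The value at [x] is the standard normal measure of the section at [x] of a measurable planar
    set. *)
Lemma measurable_gauss_shift m s A : measurable A ->
  measurable_fun [set: RR] (fun x => gauss (m + x) s A).
Proof.
move=> mA; pose B := [set p : RR * RR | A (s * p.2 + (m + p.1))].
have mB : measurable B.
  have mf : measurable_fun [set: RR * RR]
      (fun p : RR * RR => s * p.2 + (m + p.1) : RR).
    by apply: measurable_funD; [exact: measurable_funM|exact: measurable_funD].
  by rewrite -[B]setTI; exact: mf.
have := measurable_fun_xsection (normal_prob 0 1 : probability RR R) mB.
apply: eq_measurable_fun => x _ /=.
rewrite [RHS]/(normal_prob 0 1 (affine (m + x) s @^-1` A)).
congr (normal_prob _ _ _); apply/seteqP; split => y.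
  by rewrite /xsection/= inE.
by rewrite /xsection/= inE.
Qed.

(* Tonelli and a completed square: integrating out the first summand leaves a
   normal density, whose total mass is 1. *)
Lemma gauss_conv m m' s s' t A : measurable A ->
  t ^+ 2 = s ^+ 2 + s' ^+ 2 ->
  (\int[gauss m s]_x gauss (m' + x) s' A = gauss (m + m') t A)%E.
Proof.
pose gam : probability RR R := normal_prob 0 1.
move=> mA tE; have mg := measurable_gauss_shift m' s' mA.
(* A zero deviation has no density. Here the outer law is the Dirac mass at [m]; in the next case
   the inner one is a Dirac mass and the integrand an indicator. *)
have [s0|s0] := eqVneq s 0.
  rewrite [in LHS]/gauss ge0_integral_distribution//.
  rewrite (eq_integral (cst (gauss (m' + m) s' A))); last first.
    by move=> x _; rewrite /= /affine s0 mul0r add0r.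
  rewrite integral_cst// [X in (_ * X)%E](probability_setT gam) mule1 addrC.
  by apply: gauss_sqr => //; rewrite tE s0 expr0n add0r.
have [s'0|s'0] := eqVneq s' 0.
  have gE c : gauss c s' A = (\1_A c)%:E by rewrite s'0 gauss0.
  rewrite [in LHS]/gauss ge0_integral_distribution//.
  transitivity (\int[gam]_x (\1_(affine (m + m') s @^-1` A) x)%:E)%E.
    apply: eq_integral => x _; apply: etrans (gE _) _.
    by rewrite /= /affine addrCA [m' + m]addrC.
  rewrite integral_indic//; last first.
    by rewrite -[X in measurable X]setTI; exact: measurable_affine.
  rewrite setIT; apply: (@gauss_sqr (m + m') s t A mA).
  by rewrite tE s'0 expr0n addr0.
have t0 : t != 0.
  by rewrite -sqrf_eq0 tE gt_eqF// ltr_wpDr ?sqr_ge0// exprn_even_gt0.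
transitivity (\int[normal_prob m s]_x gauss (m' + x) s' A)%E.
  by apply: eq_measure_integral => B mB _; exact: gaussE.
rewrite ge0_integral_normal_prob// gaussE//.
pose F (p : RR * RR) : \bar R :=
  (normal_pdf m s p.1 * normal_pdf (m' + p.1) s' p.2 * \1_A p.2)%:E.
have F0 p : (0 <= F p)%E by rewrite lee_fin !mulr_ge0 ?normal_pdf_ge0.
have mF : measurable_fun setT F.
  apply/measurable_EFinP; apply: measurable_funM; last first.
    exact: (measurableT_comp (measurable_indic mA) measurable_snd).
  apply: measurable_funM.
    exact: (measurableT_comp (measurable_normal_pdf m s) measurable_fst).
  (* The shifted density depends on the pair only through the difference of its entries, whence
     joint measurability. *)
  rewrite (_ : (fun p => _) =
      normal_pdf m' s' \o (fun p : RR * RR => p.2 - p.1 : RR)).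
    apply: (measurableT_comp (measurable_normal_pdf m' s')).
    exact: measurable_funB.
  apply/funext => p /=; rewrite !normal_pdfE// /normal_fun.
  by rewrite opprD addrA addrAC.
have normal_probE n u : normal_prob n u A =
    (\int[leb]_z ((normal_pdf n u z)%:E * (\1_A z)%:E))%E.
  by rewrite /normal_prob integral_mkcond epatch_indic.
transitivity (\int[leb]_x \int[leb]_z F (x, z))%E.
  apply: eq_integral => x _; rewrite gaussE// normal_probE muleC.
  rewrite -ge0_integralZl//.
  - by apply: eq_integral => z _; rewrite -!EFinM mulrA.
  - apply: emeasurable_funM; apply/measurable_EFinP => //.
    exact: measurable_normal_pdf.
  - by move=> z _; rewrite -EFinM lee_fin mulr_ge0 ?normal_pdf_ge0.
  - by rewrite lee_fin normal_pdf_ge0.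
rewrite [LHS](@fubini_tonelli _ _ _ _ _ leb leb F mF F0) normal_probE.
apply: eq_integral => z _.
under eq_integral do
  rewrite /F/= (normal_pdf_conv _ _ _ _ s0 s'0 t0 tE) mulrAC EFinM.
rewrite ge0_integralZl//.
- by rewrite integral_normal_pdf mule1.
- by apply/measurable_EFinP; exact: measurable_normal_pdf.
- by move=> x _; rewrite lee_fin normal_pdf_ge0.
- by rewrite lee_fin mulr_ge0 ?normal_pdf_ge0.
Qed.

End gauss.

(** * The Gaussian tail function *)

Section Qfun_gauss.
Context (R : realType).
Implicit Types m s x y : R.
Local Notation RR := (measurableTypeR R).

Lemma QfunE x : Qfun x = fine (gauss 0 1 `[x, +oo[%classic).
Proof.
rewrite gaussE// ?oner_neq0// /normal_prob /Qfun /Rintegral.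
set c := Num.sqrt _; set I := (X in fine X).
have c0 : 0 < c^-1 by rewrite invr_gt0 sqrtr_gt0 mulr_gt0// pi_gt0.
have normal_funE t : normal_fun 0 1 t = expR (- t ^+ 2 / 2) :> R.
  by rewrite /normal_fun subr0 expr1n.
transitivity (fine (c^-1%:E * I)).
  (* [fine] sends infinite values to 0 on both sides, so the positive constant moves inside it in
     every case. *)
  by case: I => [r| |]//=; rewrite ?gt0_muley ?gt0_muleNy ?lte_fin//= mulr0.
congr fine; rewrite -ge0_integralZl//.
- apply: eq_integral => t _; rewrite -EFinM normal_pdfE ?oner_neq0//.
  rewrite normal_funE /normal_peak; congr (((Num.sqrt _)^-1 * _)%:E).
  by rewrite expr1n mul1r mulr_natl.
- apply/measurable_EFinP; apply: measurable_funTS.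
  apply: eq_measurable_fun (measurable_normal_fun 0 1) => t _.
  exact: normal_funE.
- by rewrite lee_fin; exact: ltW.
Qed.

Lemma Qfun_anti x y : x <= y -> Qfun y <= Qfun x.
Proof.
move=> xy; rewrite !QfunE; apply: fine_le; [exact: fin_num_measure..|].
apply: le_measure; [by rewrite inE|by rewrite inE|] => t /=.
by rewrite !in_itv/= !andbT; exact: le_trans.
Qed.

(** By symmetry the half-line from 0 and its reflection have the same mass, and together they cover
    the line. *)
Lemma Qfun0_ge : 2^-1 <= Qfun (0 : R).
Proof.
pose A : set RR := `[0, +oo[%classic.
have mA : measurable A by exact: measurable_itv.
have AN : (affine 0 (- 1) @^-1` A) `|` A = [set: RR].
  apply/seteqP; split => // x _; rewrite /A /affine /= !in_itv/= !andbT.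
  by rewrite mulN1r addr0 oppr_ge0; have [|/ltW] := leP x 0; [left|right].
have gN : gauss 0 1 (affine 0 (- 1) @^-1` A) = gauss 0 1 A.
  rewrite gauss_affine mulr0 addr0 mulN1r.
  by apply: gauss_sqr => //; rewrite sqrrN.
have mAN : measurable (affine 0 (- 1) @^-1` A).
  by rewrite -[X in measurable X]setTI; exact: measurable_affine.
have : (1 <= gauss 0 1 A + gauss 0 1 A)%E.
  rewrite -{1}gN -(probability_setT (gauss (0 : R) 1)) -AN.
  exact: measureU2.
rewrite QfunE -/A -{1 2}(fineK (fin_num_measure (gauss 0 1) _ mA)).
rewrite -EFinD lee_fin; lra.
Qed.

Lemma gauss_tail s x : 0 < s ->
  fine (gauss 0 s `[x, +oo[%classic) = Qfun (x / s).
Proof.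
move=> s0; rewrite QfunE; congr fine.
have -> : `[x / s, +oo[%classic = affine 0 s @^-1` `[x, +oo[%classic :> set RR.
  by apply/seteqP; split => t; rewrite /affine/= !in_itv/= !andbT addr0
    ler_pdivrMr// [t * s]mulrC.
by rewrite gauss_affine mulr0 addr0 mulr1.
Qed.

End Qfun_gauss.

(** * Sums of independent Gaussian variables *)

Section gauss_sum.
Context (R : realType) d (T : measurableType d) (P : probability T R).
Local Notation RR := (measurableTypeR R).

Lemma measurable_preimage_setT d' (T' : measurableType d') (f : T -> T') A :
  measurable_fun setT f -> measurable A -> measurable (f @^-1` A).
Proof. by move=> mf mA; rewrite -[X in measurable X]setTI; exact: mf. Qed.

(* [E] is carried along for the induction, where it absorbs the events on the
   variables that are not summed. *)
Lemma gauss_sum n (Z : 'I_n -> T -> RR) (m s : 'I_n -> R) (E : set T) :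
  measurable E -> (forall i, measurable_fun setT (Z i)) ->
  (forall B : 'I_n -> set RR, (forall i, measurable (B i)) ->
    P [set w | E w /\ forall i, B i (Z i w)] =
    (P E * \prod_(i < n) gauss (m i) (s i) (B i))%E) ->
  forall (A : set RR) t, measurable A -> t ^+ 2 = \sum_(i < n) s i ^+ 2 ->
    P [set w | E w /\ A (\sum_(i < n) Z i w)] =
    (P E * gauss (\sum_(i < n) m i) t A)%E.
Proof.
elim: n Z m s E => [|n IH] Z m s E mE mZ indepZ A t mA tE.
  have -> : t = 0 by apply/eqP; rewrite -sqrf_eq0 tE big_ord0.
  rewrite big_ord0 gauss0 indicE.
  have [A0|A0] := pselect (A 0).
    rewrite mem_set//= mule1; congr (P _); apply/seteqP; split => [w []//|w Ew].
    by split=> //; rewrite big_ord0.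
  rewrite memNset//= mule0; apply: etrans _ (measure0 P); congr (P _).
  by apply/seteqP; split => // w []; rewrite big_ord0.
pose S w : RR := \sum_(i < n) Z (lift ord0 i) w.
have mS : measurable_fun setT S.
  exact: (measurable_sum _ (fun i => mZ (lift ord0 i))).
pose m' := \sum_(i < n) m (lift ord0 i).
pose t' := Num.sqrt (\sum_(i < n) s (lift ord0 i) ^+ 2).
have t'E : t' ^+ 2 = \sum_(i < n) s (lift ord0 i) ^+ 2.
  by rewrite sqr_sqrtr// sumr_ge0// => i _; rewrite sqr_ge0.
pose g0 := gauss (m ord0) (s ord0).
(* The joint law of the first variable and the sum of the others, on rectangles: the condition on
   the first variable joins the event, and the induction hypothesis handles the rest. *)
have rect B C : measurable B -> measurable C ->
    P [set w | E w /\ (B (Z ord0 w) /\ C (S w))] =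
    (P E * g0 B * gauss m' t' C)%E.
  move=> mB mC; pose E' := [set w | E w /\ B (Z ord0 w)].
  have mE' : measurable E'.
    by apply: measurableI => //; exact: measurable_preimage_setT.
  have joint (D : 'I_n -> set RR) : (forall i, measurable (D i)) ->
      P [set w | E' w /\ forall i, D i (Z (lift ord0 i) w)] =
      (P E * g0 B *
       \prod_(i < n) gauss (m (lift ord0 i)) (s (lift ord0 i)) (D i))%E.
    move=> mD.
    pose D' (i : 'I_n.+1) := oapp D B (unlift ord0 i).
    have mD' i : measurable (D' i).
      by rewrite /D'; case: unliftP => *; [exact: mD|exact: mB].
    transitivity (P [set w | E w /\ forall i, D' i (Z i w)]).
      congr (P _); apply/seteqP; split => w.
        move=> [[Ew Bw] Dw]; split=> // i; rewrite /D'.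
        by case: unliftP => [j|] ->/=.
      move=> [Ew D'w]; split; first split=> //.
        by have := D'w ord0; rewrite /D' unlift_none.
      by move=> i; have := D'w (lift ord0 i); rewrite /D' liftK.
    rewrite indepZ// big_ord_recl /D' unlift_none /= muleA; congr (_ * _)%E.
    by apply: eq_bigr => i _; rewrite liftK.
  have PE' : P E' = (P E * g0 B)%E.
    have := joint (fun=> setT) (fun=> measurableT).
    rewrite big1 ?mule1 => [<-|i _]; last exact: probability_setT.
    by congr (P _); apply/seteqP; split => [w|w []].
  rewrite -PE' -(IH (fun i => Z (lift ord0 i)) _
    (fun i => s (lift ord0 i)) E')//.
    by congr (P _); apply/seteqP; split => w; rewrite /E'/=; tauto.
  by move=> D mD; rewrite PE' joint.
have PEfin : P E \is a fin_num by exact: fin_num_measure.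
pose c : {nonneg R} := NngNum (fine_ge0 (measure_ge0 P E)).
have cE : (c%:num)%:E = P E by rewrite /= fineK.
pose m1 := mscale c g0.
pose ZS w : RR * RR := (Z ord0 w, S w).
have mZS : measurable_fun setT ZS by exact: measurable_fun_pair.
pose X := [set p : RR * RR | A (p.1 + p.2)].
have mX : measurable X.
  rewrite -[X]setTI.
  have : measurable_fun [set: RR * RR] (fun p : RR * RR => p.1 + p.2 : RR).
    exact: measurable_funD.
  exact.
(* The joint law restricted to [E] has total mass [P E], so this factor is put into the first
   marginal [m1]. *)
pose nu := pushforward (mrestr P mE) ZS.
have nuE B C : measurable B -> measurable C ->
    nu (B `*` C) = (m1 B * gauss m' t' C)%E.
  move=> mB mC; rewrite [X in (X * _)%E](_ : _ = (P E * g0 B)%E); last first.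
    by rewrite -cE.
  rewrite -rect//; congr (P _); apply/seteqP; split => w /=; tauto.
transitivity (nu X).
  congr (P _); apply/seteqP; split => w; rewrite /= big_ord_recl; tauto.
(* Agreement on rectangles makes [nu] a product measure; integrating the sections of [X] then gives
   a convolution of two Gaussian laws. *)
apply: etrans (esym (product_measure_unique nuE mX)) _ => //.
rewrite /product_measure1.
transitivity ((c%:num)%:E * \int[g0]_x (gauss m' t' \o xsection X) x)%E.
  apply: ge0_integral_mscale => //.
  exact: measurable_fun_xsection.
rewrite -cE; congr (_ * _)%E.
transitivity (\int[g0]_x gauss (m' + x) t' A)%E.
  apply: eq_integral => x _.
  rewrite -[X in gauss _ X A](mul1r t') -[X in gauss (X + _) _ A](mul1r m').
  rewrite -gauss_affine /=; congr (gauss _ _ _); apply/seteqP; split => y;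
    rewrite /xsection /affine/= inE /X/= mul1r addrC//.
rewrite (gauss_conv _ _ mA (t := t)) ?big_ord_recl//.
by rewrite t'E tE big_ord_recl.
Qed.

End gauss_sum.

Section gauss_sum_rows.
Context (R : realType) d (T : measurableType d) (P : probability T R).
Local Notation RR := (measurableTypeR R).

(** Turns independence of all entries of an array into independence of its row sums. By induction on
    the rows: the events on the sums of the other rows join [E], and [gauss_sum] treats the first
    row. *)
Lemma gauss_sum_rows n K (Z : 'I_n -> 'I_K -> T -> RR) (m s : 'I_n -> 'I_K -> R)
    (E : set T) :
  measurable E -> (forall i k, measurable_fun setT (Z i k)) ->
  (forall B : 'I_n -> 'I_K -> set RR, (forall i k, measurable (B i k)) ->
    P [set w | E w /\ forall i k, B i k (Z i k w)] =
    (P E * \prod_(i < n) \prod_(k < K) gauss (m i k) (s i k) (B i k))%E) ->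
  forall (A : 'I_n -> set RR) (t : 'I_n -> R), (forall i, measurable (A i)) ->
    (forall i, t i ^+ 2 = \sum_(k < K) s i k ^+ 2) ->
    P [set w | E w /\ forall i, A i (\sum_(k < K) Z i k w)] =
    (P E * \prod_(i < n) gauss (\sum_(k < K) m i k) (t i) (A i))%E.
Proof.
elim: n Z m s E => [|n IH] Z m s E mE mZ indepZ A t mA tE.
  rewrite big_ord0 mule1; congr (P _).
  by apply/seteqP; split => [w []//|w Ew]; split=> // -[].
pose S i w : RR := \sum_(k < K) Z i k w.
have mS i : measurable_fun setT (S i) by exact: (measurable_sum _ (mZ i)).
pose E1 :=
  [set w | E w /\ forall i : 'I_n, A (lift ord0 i) (S (lift ord0 i) w)].
have mE1 : measurable E1.
  rewrite (_ : E1 = E `&` \bigcap_(i in [set: 'I_n])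
      (S (lift ord0 i) @^-1` A (lift ord0 i))); last first.
    by apply/seteqP; split => w [Ew Aw]; split=> // i; [move=> _|]; exact: Aw.
  apply: measurableI => //; apply: fin_bigcap_measurable => // i _.
  exact: measurable_preimage_setT.
(* The induction hypothesis, applied with the event [E0] on the entries of the first row, shows that
   these entries are still independent of [E1]. *)
have step (B : 'I_K -> set RR) : (forall k, measurable (B k)) ->
    P [set w | E1 w /\ forall k, B k (Z ord0 k w)] =
    (P E * \prod_(i < n) gauss (\sum_(k < K) m (lift ord0 i) k)
        (t (lift ord0 i)) (A (lift ord0 i)) *
     \prod_(k < K) gauss (m ord0 k) (s ord0 k) (B k))%E.
  move=> mB; pose E0 := [set w | E w /\ forall k, B k (Z ord0 k w)].
  have mE0 : measurable E0.
    rewrite (_ : E0 = E `&` \bigcap_(k in [set: 'I_K]) (Z ord0 k @^-1` B k)).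
      apply: measurableI => //; apply: fin_bigcap_measurable => // k _.
      exact: measurable_preimage_setT.
    by apply/seteqP; split => w [Ew Bw]; split=> // k; [move=> _|]; exact: Bw.
  have joint (D : 'I_n -> 'I_K -> set RR) : (forall i k, measurable (D i k)) ->
      P [set w | E0 w /\ forall i k, D i k (Z (lift ord0 i) k w)] =
      (P E * \prod_(k < K) gauss (m ord0 k) (s ord0 k) (B k) *
       \prod_(i < n) \prod_(k < K)
         gauss (m (lift ord0 i) k) (s (lift ord0 i) k) (D i k))%E.
    move=> mD; pose D' (i : 'I_n.+1) := oapp D B (unlift ord0 i).
    have mD' i k : measurable (D' i k).
      by rewrite /D'; case: unliftP => *; [exact: mD|exact: mB].
    transitivity (P [set w | E w /\ forall i k, D' i k (Z i k w)]).
      congr (P _); apply/seteqP; split => w.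
        move=> [[Ew Bw] Dw]; split=> // i k; rewrite /D'.
        by case: unliftP => [j|] ->/=.
      move=> [Ew D'w]; split; first split=> // k.
        by have := D'w ord0 k; rewrite /D' unlift_none.
      by move=> i k; have := D'w (lift ord0 i) k; rewrite /D' liftK.
    rewrite indepZ// big_ord_recl /D' unlift_none /= muleA; congr (_ * _)%E.
    by apply: eq_bigr => i _; rewrite liftK.
  have PE0 : P E0 = (P E * \prod_(k < K) gauss (m ord0 k) (s ord0 k) (B k))%E.
    have := joint (fun=> fun=> setT) (fun _ _ => measurableT).
    rewrite [X in _ = (_ * X)%E]big1 ?mule1 => [<-|i _]; last first.
      by rewrite big1// => k _; exact: probability_setT.
    by congr (P _); apply/seteqP; split => [w|w []].
  rewrite muleAC -PE0.
  rewrite -(IH (fun i => Z (lift ord0 i)) (fun i => m (lift ord0 i))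
      (fun i => s (lift ord0 i)) E0)//.
    by congr (P _); apply/seteqP; split => w; rewrite /E0 /E1/=; tauto.
  by move=> D mD; rewrite PE0 joint.
have PE1 : P E1 = (P E * \prod_(i < n) gauss (\sum_(k < K) m (lift ord0 i) k)
    (t (lift ord0 i)) (A (lift ord0 i)))%E.
  have := step (fun=> setT) (fun=> measurableT).
  rewrite [X in _ = (_ * X)%E]big1 ?mule1 => [<-|k _];
    last exact: probability_setT.
  by congr (P _); apply/seteqP; split => [w|w []].
rewrite big_ord_recl muleCA muleC -PE1.
rewrite -(gauss_sum (Z := Z ord0) (s := s ord0) mE1)//; last first.
  by move=> B mB; rewrite PE1 step.
congr (P _); apply/seteqP; split => w.
  by move=> [Ew Aw]; split; [split=> // i; exact: Aw|exact: Aw].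
by move=> [[Ew Aw] A0w]; split=> // i; case: (unliftP ord0 i) => [j|] ->.
Qed.

End gauss_sum_rows.

(** * Gaussian vectors with diagonal covariance *)

Section cV_box.
Context (R : realType) (N : nat).
Local Notation RR := (measurableTypeR R).

Definition cV_box (B : 'I_N -> set RR) : set 'cV[R]_N :=
  [set x | forall i, B i (x i ord0)].

Lemma measurable_cV_box B :
  (forall i, measurable (B i)) -> measurable (cV_box B).
Proof.
move=> mB; rewrite (_ : cV_box B = \bigcap_(i in [set: 'I_N])
    ((fun x : 'cV[R]_N => x i ord0) @^-1` B i)); last first.
  by apply/seteqP; split => x xB i => [_|]; exact: xB.
apply: fin_bigcap_measurable => // i _.
rewrite -[X in measurable X]setTI.
exact: (@measurable_coord R N i measurableT (B i) (mB i)).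
Qed.

(** Boxes are stable under intersection and generate the sigma-algebra, so they determine a finite
    measure. *)
Lemma cV_measure_unique (m1 m2 : {measure set 'cV[R]_N -> \bar R}) :
  (m1 setT < +oo)%E ->
  (forall B, (forall i, measurable (B i)) -> m1 (cV_box B) = m2 (cV_box B)) ->
  forall A, measurable A -> m1 A = m2 A.
Proof.
move=> m1fin m12.
pose G := [set A | exists2 B : 'I_N -> set RR,
  forall i, measurable (B i) & A = cV_box B].
have GT : G setT by exists (fun=> setT) => //; apply/seteqP; split.
apply: (measure_unique G (fun=> setT)) => //.
- apply/seteqP; split.
    apply: smallest_sub; first exact: smallest_sigma_algebra.
    move=> A; rewrite -bigcup_seq => -[i _ [C mC <-]].
    (* The preimage of [C] under coordinate [i] is a box with a single constrained side. *)
    apply: sub_sigma_algebra; exists (fun j => if j == i then C else setT).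
      by move=> j; case: ifP.
    rewrite setTI; apply/seteqP; split => x /=.
      by move=> Cx j; case: eqP => // ->.
    by move=> /(_ i); rewrite eqxx.
  apply: smallest_sub; first exact: sigma_algebra_measurable.
  by move=> _ [B mB ->]; exact: measurable_cV_box.
- move=> _ _ [B mB ->] [B' mB' ->]; exists (fun i => B i `&` B' i).
    by move=> i; exact: measurableI.
  apply/seteqP; split => x.
    by move=> [Bx B'x] i; split; [exact: Bx|exact: B'x].
  by move=> BB'x; split=> i; have [] := BB'x i.
- by rewrite bigcup_const.
- by move=> _ [B mB ->]; exact: m12.
Qed.

End cV_box.

(** * Integrals of products of one-coordinate functions *)

Section cV_integral.
Context (R : realType).
Local Notation RR := (measurableTypeR R).
Local Notation leb := (@lebesgue_measure R).

Lemma measurable_cV_prod N (f : 'I_N -> RR -> R) :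
  (forall i, measurable_fun setT (f i)) ->
  measurable_fun setT (fun x : 'cV[R]_N => \prod_(i < N) f i (x i ord0)).
Proof.
move=> mf; apply: measurable_prod => i _.
exact: (measurableT_comp (mf i) (measurable_coord i)).
Qed.

(** Tonelli, by induction on the dimension: [cV_lebesgue] in dimension [N.+1] is the image of a
    product measure under [cV_cons], and in dimension 0 a unit point mass. *)
Lemma ge0_integral_cV_prod N (f : 'I_N -> RR -> R) :
  (forall i, measurable_fun setT (f i)) -> (forall i x, 0 <= f i x) ->
  (\int[cV_lebesgue R N]_x (\prod_(i < N) f i (x i ord0))%:E =
   \prod_(i < N) \int[leb]_x (f i x)%:E)%E.
Proof.
elim: N f => [|N IH] f mf f0.
  rewrite big_ord0 integral_dirac//; last first.
    by apply/measurable_EFinP; exact: measurable_cV_prod.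
  by rewrite diracT mul1e big_ord0.
have mF : measurable_fun setT
    (fun x : 'cV[R]_N.+1 => (\prod_(i < N.+1) f i (x i ord0))%:E).
  by apply/measurable_EFinP; exact: measurable_cV_prod.
have mf' : measurable_fun setT (fun x : 'cV[R]_N =>
    (\prod_(i < N) f (lift ord0 i) (x i ord0))%:E).
  apply/measurable_EFinP.
  exact: (measurable_cV_prod (fun i => mf (lift ord0 i))).
have F0 (x : 'cV[R]_N.+1) : (0 <= (\prod_(i < N.+1) f i (x i ord0))%:E)%E.
  by rewrite lee_fin prodr_ge0.
rewrite [LHS](@ge0_integral_pushforward _ _ _ _ _ _ (@measurable_cV_cons R N)
   (leb \x cV_lebesgue R N)%E)//.
rewrite preimage_setT.
have mFc := measurableT_comp mF (@measurable_cV_cons R N).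
rewrite [LHS](fubini_tonelli1 _ mFc)//; last by move=> x; exact: F0.
rewrite big_ord_recl -IH//.
transitivity (\int[leb]_t ((f ord0 t)%:E *
    \int[cV_lebesgue R N]_x (\prod_(i < N) f (lift ord0 i) (x i ord0))%:E))%E.
  apply: eq_integral => t _; rewrite -ge0_integralZl//.
    apply: eq_integral => x _; rewrite /= big_ord_recl cV_cons0 EFinM.
    by congr (_ * _%:E)%E; apply: eq_bigr => i _; rewrite cV_consS.
    by move=> x _; rewrite lee_fin prodr_ge0.
  by rewrite lee_fin.
rewrite ge0_integralZr//.
- by apply/measurable_EFinP; exact: mf.
- by move=> t _; rewrite lee_fin.
- by apply: integral_ge0 => x _; rewrite lee_fin prodr_ge0.
Qed.

(** The indicator of a box is the product of the indicators of its sides. *)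
Lemma ge0_integral_cV_box N (f : 'I_N -> RR -> R) (B : 'I_N -> set RR) :
  (forall i, measurable_fun setT (f i)) -> (forall i x, 0 <= f i x) ->
  (forall i, measurable (B i)) ->
  (\int[cV_lebesgue R N]_(x in cV_box B) (\prod_(i < N) f i (x i ord0))%:E =
   \prod_(i < N) \int[leb]_(x in B i) (f i x)%:E)%E.
Proof.
move=> mf f0 mB.
transitivity (\prod_(i < N) \int[leb]_x (f i x * \1_(B i) x)%:E)%E; last first.
  apply: eq_bigr => i _; rewrite [RHS]integral_mkcond epatch_indic.
  by apply: eq_integral => x _; rewrite EFinM.
rewrite -ge0_integral_cV_prod//; last 2 first.
- by move=> i; exact: measurable_funM.
- by move=> i x; rewrite mulr_ge0.
rewrite integral_mkcond epatch_indic; apply: eq_integral => x _.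
rewrite /= -EFinM big_split; congr ((_ * _)%:E).
have [Bx|] := pselect (cV_box B x).
  rewrite indicE mem_set// big1// => i _.
  by rewrite indicE mem_set//; exact: Bx.
move=> /[dup] nBx /existsNP[i nBi]; rewrite indicE memNset//.
by rewrite (bigD1 i)//= indicE memNset// mul0r.
Qed.

End cV_integral.

Lemma sqrtr_prod (R : rcfType) (I : Type) (r : seq I) (P : pred I)
    (F : I -> R) :
  (forall i, P i -> 0 <= F i) ->
  Num.sqrt (\prod_(i <- r | P i) F i) = \prod_(i <- r | P i) Num.sqrt (F i).
Proof.
move=> F0; elim/big_rec2: _ => [|i x y Pi <-]; first exact: sqrtr1.
exact/sqrtrM/F0.
Qed.

(** * Gaussian densities with diagonal covariance *)

Section diagonal_gaussian.
Context (R : realType) (N : nat).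
Local Notation RR := (measurableTypeR R).
Implicit Types (C : 'M[R]_N) (m u x : 'cV[R]_N).

Lemma is_diag_mxE C : is_diag_mx C -> C = diag_mx (\row_i C i i).
Proof.
move=> /is_diag_mxP Cd; apply/matrixP => i j; rewrite !mxE.
by have [->|ij] := eqVneq i j; [rewrite mulr1n|rewrite mulr0n Cd].
Qed.

Lemma quad_form_diag C u : is_diag_mx C -> (forall i, 0 < C i i) ->
  quad_form C u = \sum_(i < N) u i ord0 ^+ 2 / C i i.
Proof.
move=> Cd C0; pose D : 'M[R]_N := diag_mx (\row_i (C i i)^-1).
have CD : C *m D = 1%:M.
  rewrite {1}(is_diag_mxE Cd) mulmx_diag; apply/matrixP => i j.
  by rewrite !mxE divff// gt_eqF.
have [Cu _] := mulmx1_unit CD.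
have CV : invmx C = D by rewrite -[LHS]mulmx1 -CD mulmxA mulVmx// mul1mx.
rewrite /quad_form CV mul_mx_diag mxE.
by apply: eq_bigr => i _; rewrite !mxE expr2 mulrAC.
Qed.

(** The determinant is the product of the diagonal entries, and the exponential turns the sum of
    squares into a product. *)
Lemma gaussian_pdf_diag m C x : is_diag_mx C -> (forall i, 0 < C i i) ->
  gaussian_pdf m C x =
  \prod_(i < N) normal_pdf (m i ord0) (Num.sqrt (C i i)) (x i ord0).
Proof.
move=> Cd C0; rewrite /gaussian_pdf quad_form_diag//.
have C0' i : 0 <= C i i by exact: ltW.
under [RHS]eq_bigr => i _ do rewrite normal_pdfE ?gt_eqF ?sqrtr_gt0//.
rewrite big_split/= /normal_peak /normal_fun; congr (_ * _).
  rewrite prodfV -sqrtr_prod; last first.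
    by move=> i _; rewrite sqr_sqrtr// mulrn_wge0// mulr_ge0// ltW// pi_gt0.
  congr (Num.sqrt _)^-1; rewrite {1}(is_diag_mxE Cd) det_diag.
  rewrite -[N in _ ^+ N]card_ord -prodr_const -big_split/=.
  by apply: eq_bigr => i _; rewrite mxE sqr_sqrtr// -mulr_natl; ring.
rewrite -expR_sum; congr expR.
rewrite mulNr mulr_suml -sumrN; apply: eq_bigr => i _; rewrite !mxE sqr_sqrtr//.
by rewrite mulr2n; field; rewrite gt_eqF.
Qed.

Lemma measurable_gaussian_pdf m C : is_diag_mx C -> (forall i, 0 < C i i) ->
  measurable_fun setT (gaussian_pdf m C).
Proof.
move=> Cd C0; rewrite (funext (fun x => gaussian_pdf_diag m x Cd C0)).
apply: (measurable_cV_prod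
  (f := fun i => normal_pdf (m i ord0) (Num.sqrt (C i i)))) => i.
exact: measurable_normal_pdf.
Qed.

Lemma gaussian_pdf_ge0 m C x : 0 <= gaussian_pdf m C x.
Proof. by rewrite mulr_ge0 ?expR_ge0// invr_ge0 sqrtr_ge0. Qed.

Lemma gaussian_pdf_box m C (B : 'I_N -> set RR) :
  is_diag_mx C -> (forall i, 0 < C i i) -> (forall i, measurable (B i)) ->
  (\int[cV_lebesgue R N]_(x in cV_box B) (gaussian_pdf m C x)%:E =
   \prod_(i < N) gauss (m i ord0) (Num.sqrt (C i i)) (B i))%E.
Proof.
move=> Cd C0 mB; under eq_integral do rewrite gaussian_pdf_diag//.
rewrite (ge0_integral_cV_box
  (f := fun i => normal_pdf (m i ord0) (Num.sqrt (C i i))))//.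
- apply: eq_bigr => i _; rewrite gaussE//; last by rewrite gt_eqF ?sqrtr_gt0.
- by move=> i; exact: measurable_normal_pdf.
- by move=> i x; exact: normal_pdf_ge0.
Qed.

(** Integrating the density defines a measure [nu], and [P] agrees with it on boxes. *)
Lemma gaussian_of_box m C (P : probability 'cV[R]_N R) :
  is_diag_mx C -> (forall i, 0 < C i i) ->
  (forall B : 'I_N -> set RR, (forall i, measurable (B i)) ->
    P (cV_box B) =
    (\prod_(i < N) gauss (m i ord0) (Num.sqrt (C i i)) (B i))%E) ->
  forall A, measurable A ->
    P A = (\int[cV_lebesgue R N]_(x in A) (gaussian_pdf m C x)%:E)%E.
Proof.
move=> Cd C0 PB.
pose nu A := (\int[cV_lebesgue R N]_(x in A) (gaussian_pdf m C x)%:E)%E.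
have pdf0 x : (0 <= (gaussian_pdf m C x)%:E)%E.
  by rewrite lee_fin gaussian_pdf_ge0.
have nu0 : nu set0 = 0%E by rewrite /nu integral_set0.
have nu_ge0 A : (0 <= nu A)%E by exact: integral_ge0.
have nu_sa : semi_sigma_additive nu.
  apply: semi_sigma_additive_nng_induced => //.
  by apply/measurable_EFinP; exact: measurable_gaussian_pdf.
pose nuM : {measure set 'cV[R]_N -> \bar R} :=
  HB.pack nu (isMeasure.Build _ _ _ nu nu0 nu_ge0 nu_sa).
apply: (cV_measure_unique (m1 := P) (m2 := nuM)) => [|B mB].
  by apply: (le_lt_trans (probability_le1 P measurableT)); exact: ltry.
exact: etrans (PB B mB) (esym (gaussian_pdf_box m Cd C0 mB)).
Qed.

End diagonal_gaussian.

(** * The sample mean and the classification error *)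

Section sample_mean_law.
Context (R : realType) (N K : nat) d (T : measurableType d).
Context (P : probability T R) (X : 'I_K -> {mfun T >-> 'cV[R]_N}).
Context (m : 'cV[R]_N) (C : 'M[R]_N).
Hypotheses (K0 : (0 < K)%N) (Cd : is_diag_mx C) (C0 : forall i, 0 < C i i).
Hypotheses (X_gauss : forall k, is_gaussian P m C (X k))
  (X_indep : mutually_independent P X).
Local Notation RR := (measurableTypeR R).
Local Notation Xbar := (sample_mean (fun k => X k)).

Let K0r : K%:R != 0 :> R.
Proof. by rewrite pnatr_eq0 -lt0n. Qed.

Lemma sample_meanE w i :
  Xbar w i ord0 = \sum_(k < K) affine 0 K%:R^-1 (X k w i ord0).
Proof.
rewrite /sample_mean mxE summxE mulr_sumr.
by apply: eq_bigr => k _; rewrite /affine addr0.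
Qed.

Lemma measurable_sample_mean : measurable_fun setT Xbar.
Proof.
apply/measurable_fun_cVP => i; rewrite (funext (fun w => sample_meanE w i)).
apply: measurable_sum => k.
apply: (measurableT_comp (measurable_affine 0 K%:R^-1)).
exact: (measurableT_comp (measurable_coord i)).
Qed.

(** Coordinate [i] of the mean is a sum of [K] independent Gaussian terms of mean [m i / K] and
    variance [C i i / K ^ 2]. *)
Lemma sample_mean_box (A : 'I_N -> set RR) : (forall i, measurable (A i)) ->
  P [set w | cV_box A (Xbar w)] =
  (\prod_(i < N) gauss (m i ord0) (Num.sqrt (K%:R^-1 * C i i)) (A i))%E.
Proof.
move=> mA.
pose Z i k w : RR := affine 0 K%:R^-1 (X k w i ord0).
have mZ i k : measurable_fun setT (Z i k).
  apply: (measurableT_comp (measurable_affine 0 K%:R^-1)).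
  exact: (measurableT_comp (measurable_coord i)).
have joint (B : 'I_N -> 'I_K -> set RR) : (forall i k, measurable (B i k)) ->
    P [set w | setT w /\ forall i k, B i k (Z i k w)] =
    (P setT * \prod_(i < N) \prod_(k < K) gauss (K%:R^-1 * m i ord0)
       (K%:R^-1 * Num.sqrt (C i i)) (B i k))%E.
  (* Conditions on all entries amount to one box per sample: independence gives the product over
     samples, the factored density that over coordinates. *)
  move=> mB; pose B' k i := affine 0 K%:R^-1 @^-1` B i k.
  have mB' k i : measurable (B' k i).
    by apply: measurable_preimage_setT => //; exact: measurable_affine.
  have mBox k : measurable (cV_box (B' k)) by exact: measurable_cV_box.
  rewrite probability_setT mul1e exchange_big/=.
  transitivity (\prod_(k < K) P (X k @^-1` cV_box (B' k)))%E; last first.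
    apply: eq_bigr => k _; apply: etrans (X_gauss k (mBox k)) _.
    rewrite gaussian_pdf_box//; apply: eq_bigr => i _.
    by rewrite gauss_affine addr0.
  have := X_indep [set: 'I_K]%SET mBox.
  rewrite (eq_bigl xpredT) => [<-|k]; last by rewrite finset.in_setT.
  congr (P _); apply/seteqP; split => w /=.
    by move=> [_ Bw] k _ i; exact: Bw.
  by move=> Bw; split=> // i k; apply: Bw; rewrite /= finset.in_setT.
have := gauss_sum_rows measurableT mZ joint mA
  (t := fun i => Num.sqrt (K%:R^-1 * C i i)).
rewrite probability_setT mul1e => H.
transitivity (P [set w | setT w /\ forall i, A i (\sum_(k < K) Z i k w)]).
  congr (P _); apply/seteqP; split => w.
    by move=> Aw; split=> // i; have := Aw i; rewrite sample_meanE.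
  by move=> [_ Aw] i; rewrite sample_meanE.
rewrite H => [|i].
  apply: eq_bigr => i _.
  by rewrite sumr_const card_ord -(mulr_natl (_ * _)) mulVKf.
rewrite sqr_sqrtr ?mulr_ge0 ?invr_ge0// 1?ltW//.
rewrite sumr_const card_ord exprMn sqr_sqrtr ?ltW// -(mulr_natl (_ * _)).
by field.
Qed.

Lemma sample_mean_pdf (D : set 'cV[R]_N) : measurable D ->
  P [set w | D (Xbar w)] =
  (\int[cV_lebesgue R N]_(x in D) (gaussian_pdf m (K%:R^-1 *: C) x)%:E)%E.
Proof.
move=> mD.
pose XM : {mfun T >-> 'cV[R]_N} :=
  HB.pack (Xbar) (isMeasurableFun.Build _ _ _ _ Xbar measurable_sample_mean).
apply: (gaussian_of_box (P := distribution P XM)) => //.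
- apply/is_diag_mxP => i j ij; rewrite mxE.
  by move/is_diag_mxP : Cd => ->//; rewrite mulr0.
- by move=> i; rewrite mxE mulr_gt0// invr_gt0 ltr0n.
- move=> B mB; apply: etrans (sample_mean_box mB) _.
  by apply: eq_bigr => i _; rewrite mxE.
Qed.

(** The centred and weighted coordinates are independent centred Gaussian variables, whose variances
    add up. *)
Lemma sample_mean_linear (a : 'I_N -> R) t (B : set RR) : measurable B ->
  t ^+ 2 = \sum_(i < N) a i ^+ 2 * (K%:R^-1 * C i i) ->
  P [set w | B (\sum_(i < N) a i * (Xbar w i ord0 - m i ord0))] = gauss 0 t B.
Proof.
move=> mB tE.
have CK0 i : 0 <= K%:R^-1 * C i i by rewrite mulr_ge0 ?invr_ge0// ltW.
pose Z i w : RR := affine (- (a i * m i ord0)) (a i) (Xbar w i ord0).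
have mZ i : measurable_fun setT (Z i).
  apply: (measurableT_comp (measurable_affine _ _)).
  exact: (measurableT_comp (measurable_coord i) measurable_sample_mean).
have joint (D : 'I_N -> set RR) : (forall i, measurable (D i)) ->
    P [set w | setT w /\ forall i, D i (Z i w)] =
    (P setT * \prod_(i < N) gauss 0
       (a i * Num.sqrt (K%:R^-1 * C i i)) (D i))%E.
  move=> mD; rewrite probability_setT mul1e.
  pose D' i := affine (- (a i * m i ord0)) (a i) @^-1` D i.
  have mD' i : measurable (D' i).
    by apply: measurable_preimage_setT => //; exact: measurable_affine.
  transitivity (P [set w | cV_box D' (Xbar w)]).
    by congr (P _); apply/seteqP; split => w; [case|move=> ?; split].
  rewrite sample_mean_box//; apply: eq_bigr => i _.
  by rewrite gauss_affine subrr.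
have := gauss_sum measurableT mZ joint mB (t := t).
rewrite probability_setT mul1e big1_eq => <-.
  have ZE w : \sum_(i < N) Z i w =
      \sum_(i < N) a i * (Xbar w i ord0 - m i ord0).
    by apply: eq_bigr => i _; rewrite /Z /affine mulrBr.
  by congr (P _); apply/seteqP; split => w /=; rewrite ZE; [split|case].
by rewrite tE; apply: eq_bigr => i _; rewrite exprMn sqr_sqrtr.
Qed.

End sample_mean_law.

(** * Pairwise error probabilities *)

Section classification_error.
Context (R : realType) (N K : nat) d (T : measurableType d).
Context (P : probability T R) (X : 'I_K -> {mfun T >-> 'cV[R]_N}).
Context (m : 'cV[R]_N) (C : 'M[R]_N).
Hypotheses (K0 : (0 < K)%N) (Cd : is_diag_mx C) (C0 : forall i, 0 < C i i).
Hypotheses (X_gauss : forall k, is_gaussian P m C (X k))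
  (X_indep : mutually_independent P X).
Local Notation RR := (measurableTypeR R).
Local Notation Xbar := (sample_mean (fun k => X k)).

(** Ties count as errors, so that every tie-breaking rule is covered. *)
Definition confusion (m' : 'cV[R]_N) : set T :=
  [set w | quad_form C (Xbar w - m') <= quad_form C (Xbar w - m)].

(** The vector [C^-1 (m' - m)], the direction of the linear discriminant between the two
    centroids. *)
Let a (m' : 'cV[R]_N) i := (m' i ord0 - m i ord0) / C i i.

(** Expanding both squared distances around [m], the terms quadratic in the mean cancel and a linear
    inequality remains. *)
Lemma confusionE m' : confusion m' =
  [set w | (`[quad_form C (m - m') / 2, +oo[%classic : set RR)
    (\sum_(i < N) a m' i * (Xbar w i ord0 - m i ord0))].
Proof.
apply/funext => w; rewrite /confusion /= in_itv/= andbT !quad_form_diag//.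
apply: propext; rewrite -subr_ge0.
suff -> : \sum_(i < N) (Xbar w - m) i ord0 ^+ 2 / C i i -
    \sum_(i < N) (Xbar w - m') i ord0 ^+ 2 / C i i =
  2 * (\sum_(i < N) a m' i * (Xbar w i ord0 - m i ord0) -
    (\sum_(i < N) (m - m') i ord0 ^+ 2 / C i i) / 2).
  by rewrite pmulr_rge0 ?subr_ge0.
rewrite mulrBr mulrCA divff ?mulr1// mulr_sumr -!sumrB.
have mxB (u v : 'cV[R]_N) i : (u - v) i ord0 = u i ord0 - v i ord0.
  by rewrite !mxE.
by apply: eq_bigr => i _; rewrite /a !mxB; field; rewrite gt_eqF.
Qed.

Lemma measurable_confusion m' : measurable (confusion m').
Proof.
rewrite confusionE -[X in measurable X]setTI.
have mS : measurable_fun setT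
    (fun w => \sum_(i < N) a m' i * (Xbar w i ord0 - m i ord0) : RR).
  apply: measurable_sum => i; apply: measurable_funM => //.
  apply: measurable_funB => //.
  exact: (measurableT_comp (measurable_coord i) (measurable_sample_mean X)).
by apply: mS => //; exact: measurable_itv.
Qed.

(** The linear functional has variance [g / K], and the threshold [g / 2] divided by [sqrt (g / K)]
    is [sqrt (K g) / 2]. *)
Lemma probability_confusion m' : 0 < quad_form C (m - m') ->
  fine (P (confusion m')) = Qfun (Num.sqrt (K%:R * quad_form C (m - m')) / 2).
Proof.
set g := quad_form C _ => g0.
have K0r : 0 < K%:R :> R by rewrite ltr0n.
have t0 : 0 < Num.sqrt (K%:R^-1 * g) by rewrite sqrtr_gt0 mulr_gt0// invr_gt0.
rewrite confusionE.
rewrite (sample_mean_linear K0 Cd C0 X_gauss X_indep (measurable_itv _)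
  (t := Num.sqrt (K%:R^-1 * g))); last first.
  rewrite sqr_sqrtr; last by rewrite mulr_ge0 ?invr_ge0// ltW.
  rewrite /g quad_form_diag// mulr_sumr; apply: eq_bigr => i _.
  by rewrite /a !mxE; field; rewrite !gt_eqF.
rewrite gauss_tail//; congr Qfun.
have gE : Num.sqrt (K%:R * g) * Num.sqrt (K%:R^-1 * g) = g.
  rewrite -sqrtrM; last by rewrite ltW// mulr_gt0.
  by rewrite mulrACA divff ?gt_eqF// mul1r -expr2 sqrtr_sqr gtr0_norm.
rewrite mulrAC; congr (_ / 2); apply: (mulIf (lt0r_neq0 t0)).
by rewrite gE divfK// gt_eqF.
Qed.

End classification_error.

(** The union bound, for events whose union has probability 1. *)
Lemma probability_cover (R : realType) d (T : measurableType d)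
    (P : probability T R) n (F : 'I_n -> set T) :
  (forall i, measurable (F i)) -> (forall w, exists i, F i w) ->
  1 <= \sum_(i < n) fine (P (F i)).
Proof.
move=> mF covF.
have sub (r : seq 'I_n) : fine (P (\big[setU/set0]_(i <- r) F i)) <=
    \sum_(i <- r) fine (P (F i)).
  elim: r => [|i r IH]; first by rewrite !big_nil measure0.
  rewrite !big_cons; apply: le_trans (lerD (lexx _) IH).
  have mr : measurable (\big[setU/set0]_(j <- r) F j).
    exact: bigsetU_measurable.
  rewrite -fineD ?fin_num_measure//; apply: fine_le.
  - by apply: fin_num_measure; exact: measurableU.
  - by rewrite fin_numD !fin_num_measure.
  - exact: measureU2.
apply: le_trans (sub _).
suff -> : \big[setU/set0]_(i < n) F i = setT by rewrite probability_setT.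
apply/seteqP; split => // w _; have [i Fiw] := covF w.
by rewrite -bigcup_seq; exists i => //=; rewrite mem_index_enum.
Qed.

(** * The minimum discriminant gain *)

Section min_gain.
Context (R : realType) (N L : nat) (mu : 'I_L -> 'cV[R]_N) (C : 'M[R]_N).
Hypotheses (Cd : is_diag_mx C) (C0 : forall i, 0 < C i i).

Lemma quad_form_ge0 u : 0 <= quad_form C u.
Proof.
rewrite quad_form_diag//; apply: sumr_ge0 => i _.
by rewrite divr_ge0 ?sqr_ge0// ltW.
Qed.

Lemma quad_formZ k u : 0 < k -> quad_form (k *: C) u = k^-1 * quad_form C u.
Proof.
move=> k0; rewrite !quad_form_diag//; last 2 first.
- apply/is_diag_mxP => i j ij; rewrite mxE.
  by move/is_diag_mxP : Cd => ->//; rewrite mulr0.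
- by move=> i; rewrite mxE mulr_gt0.
rewrite mulr_sumr; apply: eq_bigr => i _; rewrite mxE.
by field; rewrite !gt_eqF.
Qed.

Let big_gain := \big[Order.min/+oo%E]_(p : 'I_L * 'I_L | p.1 != p.2)
  (discriminant_gain mu C p.1 p.2)%:E.

Let big_gain_ge0 : (0 <= big_gain)%E.
Proof. by apply: le_bigmin => // p _; rewrite lee_fin quad_form_ge0. Qed.

Lemma min_gain_ge0 : 0 <= min_gain mu C.
Proof. exact: fine_ge0. Qed.

Lemma min_gain_le l l' : l != l' ->
  min_gain mu C <= discriminant_gain mu C l l'.
Proof.
move=> ll'.
have le : (big_gain <= (discriminant_gain mu C l l')%:E)%E.
  exact: (@bigmin_le_cond _ _ _ _ (l, l')).
(* The minimum lies between 0 and a real gain, so it is finite and [fine] preserves it. *)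
rewrite -lee_fin fineK// ge0_fin_numE//; exact: le_lt_trans le (ltry _).
Qed.

End min_gain.

(** * The lower bound on the accuracy *)

Theorem lemma1 (R : realType) (L K N : nat)
    (hL : (2 <= L)%N) (hK : (1 <= K)%N) (hN : (1 <= N)%N)
    (mu : 'I_L -> 'cV[R]_N)
    (C : 'M[R]_N) (C_diag : is_diag_mx C) (C_gt0 : forall n, 0 < C n n)
    (d : measure_display) (Omega : measurableType d)
    (P : 'I_L -> probability Omega R)
    (X : 'I_K -> {mfun Omega >-> 'cV[R]_N})
    (X_gauss : forall l k, is_gaussian (P l) (mu l) C (X k))
    (X_indep : forall l, mutually_independent (P l) X)
    (lhat : 'cV[R]_N -> 'I_L) (lhat_argmin : is_argmin_classifier mu C lhat) :
  Num.max (L%:R^-1)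
      (1 - (L%:R - 1) * Qfun (Num.sqrt (K%:R * min_gain mu C) / 2))
    <= accuracy P X lhat.
Proof.
have [mlhat lhat_min] := lhat_argmin.
have L0 : 0 < L%:R :> R by rewrite ltr0n (leq_trans _ hL).
have K0 : 0 < K%:R^-1 :> R by rewrite invr_gt0 ltr0n.
pose Xbar := sample_mean (fun k => X k).
have mXbar : measurable_fun setT Xbar := measurable_sample_mean X.
pose D l := lhat @^-1` [set l].
pose hit l := [set w | D l (Xbar w)].
have mhit l : measurable (hit l).
  exact: (measurable_preimage_setT mXbar (mlhat l)).
have accE : accuracy P X lhat = L%:R^-1 * \sum_(l < L) fine (P l (hit l)) by [].
have guess : L%:R^-1 <= accuracy P X lhat.
  rewrite accE -[leLHS]mulr1 ler_pM2l ?invr_gt0//.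
  pose l0 : 'I_L := Ordinal (leq_trans (isT : (0 < 2)%N) hL).
  apply: (@le_trans _ _ (\sum_(l < L) fine (P l0 (hit l)))).
    by apply: probability_cover => // w; exists (lhat (Xbar w)).
  apply: ler_sum => l _; apply: fine_le; [exact: fin_num_measure..|].
  have KC_diag : is_diag_mx (K%:R^-1 *: C).
    apply/is_diag_mxP => i j ij; rewrite mxE.
    by move/is_diag_mxP : C_diag => ->//; rewrite mulr0.
  have KC_gt0 i : 0 < (K%:R^-1 *: C) i i by rewrite mxE mulr_gt0.
  have pdf l' :=
    sample_mean_pdf hK C_diag C_gt0 (X_gauss l') (X_indep l') (mlhat l).
  have := pdf l; have := pdf l0; rewrite -/(hit l) => -> ->.
  have mpdf l' :
      measurable_fun (D l) (EFin \o gaussian_pdf (mu l') (K%:R^-1 *: C)).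
    apply: measurable_funTS; apply/measurable_EFinP.
    exact: measurable_gaussian_pdf.
  apply: ge0_le_integral => //.
  - by move=> x _; rewrite lee_fin gaussian_pdf_ge0.
  - exact: mpdf.
  - exact: mpdf.
  - move=> x Dx; rewrite lee_fin /gaussian_pdf ler_wpM2l ?invr_ge0//.
    rewrite ler_expR !mulNr lerN2 ler_pM2r ?invr_gt0// !quad_formZ//.
    rewrite ler_pM2l ?invr_gt0 ?ltr0n//.
    by rewrite -{1}Dx.
rewrite ge_max guess/=.
have [g0|g_gt0] := leP (min_gain mu C) 0.
  apply: le_trans guess.
  have -> : min_gain mu C = 0.
    by apply/eqP; rewrite eq_le g0 min_gain_ge0.
  rewrite mulr0 sqrtr0 mul0r.
  have := @Qfun0_ge R.
  have : 2 <= L%:R :> R by rewrite ler_nat.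
  move: L0; set x := L%:R; set q := Qfun 0 => x0 x2 q2.
  rewrite -[x^-1]mul1r ler_pdivlMr//.
  (* As [q] is at least 1/2, [x (1 - (x - 1) q)] is at most [x - x (x - 1) / 2], which falls short
     of 1 by [(x - 1) (x - 2) / 2]. *)
  have : 0 <= (x - 1) * x * (q - 2^-1).
    by rewrite !mulr_ge0 ?subr_ge0// ?ltW// (lt_le_trans _ x2)// ltr1n.
  have : 0 <= (x - 2) * (x - 1).
    by rewrite mulr_ge0 ?subr_ge0// ltW// (lt_le_trans _ x2)// ltr1n.
  nra.
set Q := Qfun _.
have step l : 1 - (L%:R - 1) * Q <= fine (P l (hit l)).
  (* These [L] events cover the space: a wrong estimate is itself a class at least as close to the
     mean as [l]. *)
  pose F l' := if l' == l then hit l else confusion X (mu l) C (mu l').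
  have : 1 <= \sum_(l' < L) fine (P l (F l')).
    apply: probability_cover => [l'|w].
      rewrite /F; case: ifP => // _; exact: measurable_confusion.
    exists (lhat (Xbar w)); rewrite /F; case: eqP => [//|_].
    exact: lhat_min.
  rewrite (bigD1 l)//= {1}/F eqxx => le1.
  rewrite lerBlDr; apply: (le_trans le1); rewrite lerD2l.
  apply: (@le_trans _ _ (\sum_(l' < L | l' != l) Q)); last first.
    rewrite sumr_const cardC1 card_ord -[_ *+ _]mulr_natl.
    by rewrite -subn1 natrB// (leq_trans _ hL).
  apply: ler_sum => l' l'l; rewrite /F (negbTE l'l).
  have ge := min_gain_le mu C_diag C_gt0 (l := l) (l' := l').
  have {}ge : min_gain mu C <= quad_form C (mu l - mu l').
    by apply: ge; rewrite eq_sym.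
  rewrite (probability_confusion hK C_diag C_gt0 (X_gauss l) (X_indep l));
    last exact: lt_le_trans ge.
  (* [Qfun] is nonincreasing, so the smallest gain gives the largest pairwise error. *)
  apply: Qfun_anti; rewrite ler_pM2r ?invr_gt0// ler_wsqrtr//.
  exact: ler_wpM2l.
rewrite accE [L%:R^-1 * _]mulrC ler_pdivlMr// mulr_natr.
rewrite -[X in _ *+ X]card_ord -sumr_const.
by apply: ler_sum => l _; exact: step.
Qed.
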